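(* Let $K$ be a field and $q\ge2$. Let $\mathcal{A}$ and $\mathcal{B}$ be D$_q$ subalgebras of $\mathrm{M}_n(K)$ of types $(n_1,n_2,\ldots,n_q)$ and $(\ell_1,\ell_2,\ldots,\ell_q)$, respectively, with max-comm db's, and write $\mathcal{A}_{ii}$ and $\mathcal{B}_{ii}$, $i=1,2,\ldots,q$, for the diagonal blocks of $\mathcal{A}$ and $\mathcal{B}$, respectively. Then $\mathcal{A}$ and $\mathcal{B}$ are conjugates if and only if the $q$-tuples $(n_1,n_2,\ldots,n_q)$ and $(\ell_1,\ell_2,\ldots,\ell_q)$ are equal and, for every $i=1,2,\ldots,q$, $\mathcal{A}_{ii}$ and $\mathcal{B}_{ii}$ are conjugates.
   Context: All algebras are associative and unital over the field $K$; a subalgebra of $\mathrm{M}_m(K)$ is a (unital) $K$-subalgebra. Subalgebras $\mathcal{S},\mathcal{T}$ of $\mathrm{M}_m(K)$ are conjugates (conjugated) if $\mathcal{T}=X^{-1}\mathcal{S}X$ for some invertible $X\in\mathrm{M}_m(K)$. $[x,y]=xy-yx$. An algebra is D$_q$ if it satisfies the identity $[x_1,y_1][x_2,y_2]\cdots[x_q,y_q]=0$. For positive integers $n_1,\ldots,n_q$ ($q\ge 2$) with $n_1+\cdots+n_q=n$, view matrices in $\mathrm{M}_n(K)$ as $q\times q$ block matrices whose $(i,j)$ block has size $n_i\times n_j$. A subalgebra $\mathcal{A}$ of $\mathrm{M}_n(K)$ is of type $(n_1,\ldots,n_q)$ if there are subalgebras $\mathcal{A}_{ii}$ of $\mathrm{M}_{n_i}(K)$,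 $i=1,\ldots,q$ (its diagonal blocks), such that $\mathcal{A}$ consists of exactly all block matrices whose $(i,i)$ block lies in $\mathcal{A}_{ii}$ (independently for each $i$), whose $(i,j)$ block is an arbitrary element of $\mathrm{M}_{n_i\times n_j}(K)$ for $i<j$, and whose $(i,j)$ block is zero for $i>j$. It is a D$_q$ subalgebra of $\mathrm{M}_n(K)$ of type $(n_1,\ldots,n_q)$ with max-comm db's if, moreover, every $\mathcal{A}_{ii}$ is a maximal commutative subalgebra of $\mathrm{M}_{n_i}(K)$ (such an algebra automatically satisfies the D$_q$ identity). *)

(* Defs.v *)
From mathcomp Require Import all_boot all_order all_algebra.
Set Implicit Arguments.
Unset Strict Implicit.
Unset Printing Implicit Defensive.
Import GRing.Theory.
Local Open Scope ring_scope.

(* 'M[K]_m has no canonical K-algebra structure for variable m (the zero ring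
   at m = 0), so subalgebras are subspaces satisfying the predicate below;
   every K-subspace of 'M[K]_m, being finite-dimensional, is a {vspace}. *)
Definition is_subalgebra (K : fieldType) (m : nat) (S : {vspace 'M[K]_m}) :=
  1%:M \in S /\ {in S &, forall x y, x *m y \in S}.

Definition conjugated (K : fieldType) (m : nat) (S T : {vspace 'M[K]_m}) :=
  exists2 X : 'M[K]_m, X \in unitmx &
    forall M, M \in T <-> exists2 s, s \in S & M = invmx X *m s *m X.

Definition is_comm_subalgebra (K : fieldType) (m : nat)
    (C : {vspace 'M[K]_m}) :=
  is_subalgebra C /\ {in C &, forall x y, x *m y = y *m x}.

Definition is_max_comm_subalgebra (K : fieldType) (m : nat)
    (C : {vspace 'M[K]_m}) :=
  is_comm_subalgebra C /\
  forall D : {vspace 'M[K]_m}, is_comm_subalgebra D -> (C <= D)%VS -> D = C.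

Definition block (K : fieldType) (n q : nat) (t : q.-tuple nat)
    (ht : (\sum_(i < q) tnth t i)%N = n) (M : 'M[K]_n) (i j : 'I_q) :
    'M[K]_(tnth t i, tnth t j) :=
  submxblock (p_ := tnth t) (q_ := tnth t) (castmx (esym ht, esym ht) M) i j.

Definition is_of_type (K : fieldType) (n q : nat) (t : q.-tuple nat)
    (ht : (\sum_(i < q) tnth t i)%N = n)
    (D : forall i : 'I_q, {vspace 'M[K]_(tnth t i)}) (A : {vspace 'M[K]_n}) :=
  [/\ forall i : 'I_q, (0 < tnth t i)%N,
      is_subalgebra A,
      forall i : 'I_q, is_subalgebra (D i)
    & forall M : 'M[K]_n, M \in A <->
        (forall i : 'I_q, block ht M i i \in D i) /\
        (forall i j : 'I_q, (j < i)%N -> block ht M i j = 0)].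

(* Such an A automatically satisfies [x_1, y_1] ... [x_q, y_q] = 0. *)
Definition is_Dq_max_comm (K : fieldType) (n q : nat) (t : q.-tuple nat)
    (ht : (\sum_(i < q) tnth t i)%N = n)
    (D : forall i : 'I_q, {vspace 'M[K]_(tnth t i)}) (A : {vspace 'M[K]_n}) :=
  is_of_type ht D A /\ forall i : 'I_q, is_max_comm_subalgebra (D i).

(* Main.v *)
(* If B = X^-1 A X, then X^-1 (strict upper part of A) X lies in the strict
   upper part of B: every matrix with a single nonzero block, above the
   diagonal, is a commutator of two elements of A, while commutators in B have
   zero diagonal blocks because the diagonal blocks of B commute.  Hence
   the flags of row spaces attached to the two block decompositions are mapped
   to each other, i.e. X and X^-1 are block upper triangular for the mixed
   block decompositions.  Their diagonal blocks are then mutually inverse, so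
   they are square and conjugate the diagonal blocks of A into those of B. *)
Require Import Defs.
From mathcomp Require Import all_boot all_order all_algebra.
Set Implicit Arguments.
Unset Strict Implicit.
Unset Printing Implicit Defensive.
Import GRing.Theory.
Local Open Scope ring_scope.

Lemma castmxM (K : fieldType) m m' n n' p p' (em : m = m') (en : n = n')
    (ep : p = p') (M : 'M[K]_(m, n)) (N : 'M[K]_(n, p)) :
  castmx (em, ep) (M *m N) = castmx (em, en) M *m castmx (en, ep) N.
Proof. by case: m' / em; case: n' / en; case: p' / ep; rewrite !castmx_id. Qed.

(** * Block calculus for matrices whose rows and columns are cut independently *)

Section MixedBlocks.
Variables (K : fieldType) (n q : nat).
Implicit Types (p r s : 'I_q -> nat).

(* The rows and the columns may be cut differently: this is needed for a matrix
   conjugating A into B before the two types are known to be equal.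
   [block ht] is convertible to [mixed_block ht ht]. *)
Definition mixed_block p r (hp : (\sum_(i < q) p i)%N = n)
    (hr : (\sum_(i < q) r i)%N = n) (M : 'M[K]_n) i j : 'M[K]_(p i, r j) :=
  submxblock (p_ := p) (q_ := r) (castmx (esym hp, esym hr) M) i j.

Definition of_blocks p r (hp : (\sum_(i < q) p i)%N = n)
    (hr : (\sum_(i < q) r i)%N = n) (B : forall i j, 'M[K]_(p i, r j)) :
    'M[K]_n :=
  castmx (hp, hr) (\mxblock_(i, j) B i j).

Lemma of_blocksK p r hp hr (B : forall i j, 'M[K]_(p i, r j)) i j :
  mixed_block hp hr (of_blocks hp hr B) i j = B i j.
Proof. by rewrite /mixed_block /of_blocks castmxK mxblockK. Qed.

Lemma mixed_blockP p r (hp : (\sum_(i < q) p i)%N = n)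
    (hr : (\sum_(i < q) r i)%N = n) M N :
  (forall i j, mixed_block hp hr M i j = mixed_block hp hr N i j) -> M = N.
Proof.
move=> eqMN; apply: (can_inj (castmxKV hp hr)).
by apply/mxblockP.
Qed.

Lemma mixed_blockM p r s (hp : (\sum_(i < q) p i)%N = n)
    (hr : (\sum_(i < q) r i)%N = n) (hs : (\sum_(i < q) s i)%N = n) M N i k :
  mixed_block hp hs (M *m N) i k =
    \sum_j mixed_block hp hr M i j *m mixed_block hr hs N j k.
Proof.
(* Reassembling the candidate blocks lets [mul_mxblock] be read backwards. *)
suff -> : M *m N = of_blocks hp hs (fun i k =>
    \sum_j mixed_block hp hr M i j *m mixed_block hr hs N j k).
  by rewrite of_blocksK.
rewrite /of_blocks -mul_mxblock !submxblockK -castmxM.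
by rewrite castmx_comp castmx_id.
Qed.

Lemma mixed_block0 p r (hp : (\sum_(i < q) p i)%N = n)
    (hr : (\sum_(i < q) r i)%N = n) i j :
  mixed_block hp hr 0 i j = 0.
Proof. by apply/matrixP=> a b; rewrite !(mxE, castmxE). Qed.

Lemma mixed_blockB p r (hp : (\sum_(i < q) p i)%N = n)
    (hr : (\sum_(i < q) r i)%N = n) M N i j :
  mixed_block hp hr (M - N) i j =
    mixed_block hp hr M i j - mixed_block hp hr N i j.
Proof. by apply/matrixP=> a b; rewrite !(mxE, castmxE). Qed.

Definition diag_blocks p (hp : (\sum_(i < q) p i)%N = n)
    (Z : forall i, 'M[K]_(p i)) : 'M[K]_n :=
  castmx (hp, hp) (\mxdiag_i Z i).

Lemma diag_blocks1 p (hp : (\sum_(i < q) p i)%N = n) :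
  diag_blocks hp (fun=> 1%:M) = 1%:M.
Proof. by rewrite /diag_blocks mxdiagZ; case: n / hp; rewrite castmx_id. Qed.

Lemma diag_blocksE p (hp : (\sum_(i < q) p i)%N = n)
    (Z : forall i, 'M[K]_(p i)) i :
  mixed_block hp hp (diag_blocks hp Z) i i = Z i.
Proof. by rewrite of_blocksK eqxx conform_mx_id. Qed.

Lemma diag_blocks0 p (hp : (\sum_(i < q) p i)%N = n)
    (Z : forall i, 'M[K]_(p i)) i j :
  i != j -> mixed_block hp hp (diag_blocks hp Z) i j = 0.
Proof. by rewrite of_blocksK => /negPf->. Qed.

Lemma mixed_block1 p (hp : (\sum_(i < q) p i)%N = n) i :
  mixed_block hp hp 1%:M i i = 1%:M.
Proof. by rewrite -(diag_blocks1 hp) diag_blocksE. Qed.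

Lemma mul_diag_blocks p r (hp : (\sum_(i < q) p i)%N = n)
    (hr : (\sum_(i < q) r i)%N = n) (Z : forall i, 'M[K]_(p i)) M i j :
  mixed_block hp hr (diag_blocks hp Z *m M) i j = Z i *m mixed_block hp hr M i j.
Proof.
rewrite (mixed_blockM hp hp hr) (bigD1 i) //= diag_blocksE big1 ?addr0 // => k ki.
by rewrite diag_blocks0 ?mul0mx // eq_sym.
Qed.

Lemma mul_mx_diag_blocks p r (hp : (\sum_(i < q) p i)%N = n)
    (hr : (\sum_(i < q) r i)%N = n) (Z : forall i, 'M[K]_(r i)) M i j :
  mixed_block hp hr (M *m diag_blocks hr Z) i j = mixed_block hp hr M i j *m Z j.
Proof.
rewrite (mixed_blockM hp hr hr) (bigD1 j) //= diag_blocksE big1 ?addr0 // => k kj.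
by rewrite diag_blocks0 ?mulmx0.
Qed.

(** [conform_mx] only transports [W] to the size of block [(k, l)]: once the test succeeds the sizes
    agree, so its default [0] is never returned. *)
Definition single_block p (hp : (\sum_(i < q) p i)%N = n) i j
    (W : 'M[K]_(p i, p j)) : 'M[K]_n :=
  of_blocks hp hp
    (fun k l => if (k == i) && (l == j) then conform_mx 0 W else 0).

Lemma single_blockE p (hp : (\sum_(i < q) p i)%N = n) i j
    (W : 'M[K]_(p i, p j)) :
  mixed_block hp hp (single_block hp W) i j = W.
Proof. by rewrite of_blocksK !eqxx conform_mx_id. Qed.

Lemma single_block0 p (hp : (\sum_(i < q) p i)%N = n) i j
    (W : 'M[K]_(p i, p j)) k l :
  (k != i) || (l != j) -> mixed_block hp hp (single_block hp W) k l = 0.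
Proof. by rewrite -negb_and of_blocksK => /negPf->. Qed.

Lemma mul_single_block p r (hp : (\sum_(i < q) p i)%N = n)
    (hr : (\sum_(i < q) r i)%N = n) i j (W : 'M[K]_(p i, p j)) M l :
  mixed_block hp hr (single_block hp W *m M) i l =
    W *m mixed_block hp hr M j l.
Proof.
rewrite (mixed_blockM hp hp hr) (bigD1 j) //= single_blockE big1 ?addr0 //.
by move=> k kj; rewrite single_block0 ?mul0mx // kj orbT.
Qed.

Definition upper_triangular p r (hp : (\sum_(i < q) p i)%N = n)
    (hr : (\sum_(i < q) r i)%N = n) M :=
  forall i j : 'I_q, (j < i)%N -> mixed_block hp hr M i j = 0.

Lemma upper_triangularM p r s (hp : (\sum_(i < q) p i)%N = n)
    (hr : (\sum_(i < q) r i)%N = n) (hs : (\sum_(i < q) s i)%N = n) M N :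
  upper_triangular hp hr M -> upper_triangular hr hs N ->
  upper_triangular hp hs (M *m N).
Proof.
move=> uM uN i k ki; rewrite (mixed_blockM hp hr hs) big1 // => j _.
have [ji|ij] := ltnP j i; first by rewrite uM ?mul0mx.
by rewrite uN ?mulmx0 // (leq_trans ki).
Qed.

(** Any intermediate index other than [i] puts one factor below the diagonal. The three cuttings are
    independent, so this covers a conjugator whose diagonal blocks are not yet known to be
    square. *)
Lemma diag_upper_triangularM p r s (hp : (\sum_(i < q) p i)%N = n)
    (hr : (\sum_(i < q) r i)%N = n) (hs : (\sum_(i < q) s i)%N = n) M N i :
  upper_triangular hp hr M -> upper_triangular hr hs N ->
  mixed_block hp hs (M *m N) i i =
    mixed_block hp hr M i i *m mixed_block hr hs N i i.
Proof.
move=> uM uN; rewrite (mixed_blockM hp hr hs) (bigD1 i) //= big1 ?addr0 //.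
move=> j; rewrite neq_ltn => /orP[ji|ij]; first by rewrite uM ?mul0mx.
by rewrite uN ?mulmx0.
Qed.

End MixedBlocks.

(** Naming the inverse [Y] makes the two algebras play symmetric roles, so that every fact about [X]
    can be reused for [Y]. *)
Lemma conjugatedP (K : fieldType) (m : nat) (S T : {vspace 'M[K]_m}) :
  conjugated S T <->
  exists X Y : 'M[K]_m, X *m Y = 1%:M /\
    forall M, M \in T <-> X *m M *m Y \in S.
Proof.
split=> [[X uX eqT]|[X [Y [XY eqT]]]].
  exists X, (invmx X); split=> [|M]; first exact: mulmxV.
  split=> [/eqT[s sS ->]|sS].
    by rewrite !mulmxA mulmxV // mul1mx mulmxK.
  by apply/eqT; eexists; first exact: sS; rewrite !mulmxA mulVmx // mul1mx mulmxKV.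
have [uX _] := mulmx1_unit XY.
have eqY : Y = invmx X by rewrite -[Y](mulKmx uX) XY mulmx1.
exists X => // M; rewrite -eqY; have YX := mulmx1C XY.
split=> [/eqT sS|[s sS ->]].
  by eexists; first exact: sS; rewrite !mulmxA YX mul1mx -mulmxA YX mulmx1.
by apply/eqT; rewrite !mulmxA XY mul1mx -mulmxA XY mulmx1.
Qed.

(** * Block triangular algebras and the matrices conjugating them *)

Section BlockAlgebras.
Variables (K : fieldType) (n q : nat).
Implicit Types (t : q.-tuple nat).

Lemma mem_of_type t (ht : (\sum_(i < q) tnth t i)%N = n)
    (D : forall i : 'I_q, {vspace 'M[K]_(tnth t i)}) A :
  is_of_type ht D A -> forall M, M \in A <->
    (forall i, mixed_block ht ht M i i \in D i) /\ upper_triangular ht ht M.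
Proof. by case. Qed.

Lemma mem_diag_single_block t (ht : (\sum_(i < q) tnth t i)%N = n)
    (D : forall i : 'I_q, {vspace 'M[K]_(tnth t i)}) A i
    (W : 'M[K]_(tnth t i)) :
  is_of_type ht D A -> W \in D i -> single_block ht W \in A.
Proof.
move=> tA WD; apply/(mem_of_type tA); split=> [j|j k kj].
  have [->|ji] := eqVneq j i; first by rewrite single_blockE.
  by rewrite single_block0 ?ji ?mem0v.
rewrite single_block0 // -negb_and; apply: contraTN kj => /andP[/eqP-> /eqP->].
by rewrite ltnn.
Qed.

Lemma mem_upper_single_block t (ht : (\sum_(i < q) tnth t i)%N = n)
    (D : forall i : 'I_q, {vspace 'M[K]_(tnth t i)}) A (i j : 'I_q)
    (W : 'M[K]_(tnth t i, tnth t j)) :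
  is_of_type ht D A -> (i < j)%N -> single_block ht W \in A.
Proof.
move=> tA ij; apply/(mem_of_type tA); split=> [k|k l lk].
  rewrite single_block0 ?mem0v //; have [->|//] := eqVneq k i.
  by rewrite neq_ltn ij.
rewrite single_block0 // -negb_and; apply: contraTN lk => /andP[/eqP-> /eqP->].
by rewrite -leqNgt ltnW.
Qed.

Lemma diag_single_block_mul t (ht : (\sum_(i < q) tnth t i)%N = n)
    (i j : 'I_q) (W : 'M[K]_(tnth t i, tnth t j)) :
  single_block ht (1%:M : 'M[K]_(tnth t i)) *m single_block ht W =
    single_block ht W.
Proof.
apply: (@mixed_blockP _ _ _ _ _ ht ht) => k l.
have [->|ki] := eqVneq k i; first by rewrite mul_single_block mul1mx.
rewrite (mixed_blockM ht ht ht) big1 ?single_block0 ?ki // => m _.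
by rewrite single_block0 ?mul0mx ?ki.
Qed.

(** With [diag_single_block_mul], this exhibits an off-diagonal block as its own commutator with the
    identity block at [i]. *)
Lemma single_block_mul_diag t (ht : (\sum_(i < q) tnth t i)%N = n)
    (i j : 'I_q) (W : 'M[K]_(tnth t i, tnth t j)) :
  i != j ->
  single_block ht W *m single_block ht (1%:M : 'M[K]_(tnth t i)) = 0.
Proof.
move=> ij; apply: (@mixed_blockP _ _ _ _ _ ht ht) => k l.
rewrite (mixed_blockM ht ht ht) mixed_block0 big1 // => m _.
have [->|mi] := eqVneq m i.
  by rewrite single_block0 ?mul0mx ?ij ?orbT.
by rewrite [X in _ *m X]single_block0 ?mulmx0 ?mi.
Qed.

Lemma commutator_diag0 t (ht : (\sum_(i < q) tnth t i)%N = n)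
    (D : forall i : 'I_q, {vspace 'M[K]_(tnth t i)}) A M N i :
  is_Dq_max_comm ht D A -> M \in A -> N \in A ->
  mixed_block ht ht (M *m N - N *m M) i i = 0.
Proof.
move=> [tA mD] /(mem_of_type tA)[dM uM] /(mem_of_type tA)[dN uN].
have [[_ comm] _] := mD i.
rewrite mixed_blockB !(diag_upper_triangularM (hr := ht)) //.
by rewrite (comm _ _ (dM i) (dN i)) subrr.
Qed.

Lemma conjugator_upper_triangular t u
    (ht : (\sum_(i < q) tnth t i)%N = n) (hu : (\sum_(i < q) tnth u i)%N = n)
    (D : forall i : 'I_q, {vspace 'M[K]_(tnth t i)})
    (C : forall i : 'I_q, {vspace 'M[K]_(tnth u i)}) A B (X Y : 'M[K]_n) :
  is_Dq_max_comm ht D A -> is_Dq_max_comm hu C B -> X *m Y = 1%:M ->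
  (forall M, M \in A -> Y *m M *m X \in B) -> upper_triangular ht hu X.
Proof.
move=> DA CB XY conjAB; have [tA _] := DA; have [tB _] := CB.
have [t0 _ D1 _] := tA.
suff uX m : forall i j : 'I_q, i = m :> nat -> (j < i)%N ->
  mixed_block ht hu X i j = 0 by move=> i j; apply: uX.
(* Induction on the row of blocks: row [m.+1] is reached from row [m] through an element of [A]
   supported on block [(m, m.+1)]. *)
elim: m => [|m IHm] i j im; rewrite im // => jm.
have lt_mq : (m < q)%N by apply: ltn_trans (ltn_ord i); rewrite im.
pose i' := Ordinal lt_mq.
have i'i : (i' < i)%N by rewrite im.
apply/row_matrixP=> a; rewrite row0 rowE.
(* Left multiplication by [W] moves row [a] to row 0, which exists because the parts of the type are
   positive. *)
pose W : 'M[K]_(tnth t i', tnth t i) := delta_mx (Ordinal (t0 i')) a.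
suff WX0 : W *m mixed_block ht hu X i j = 0.
  have -> : delta_mx 0 a = delta_mx 0 (Ordinal (t0 i')) *m W :> 'rV[K]_(tnth t i).
    by rewrite mul_delta_mx.
  by rewrite -mulmxA WX0 mulmx0.
rewrite -(mul_single_block ht hu).
pose E := single_block ht W; pose P := single_block ht (1%:M : 'M[K]_(tnth t i')).
have EA : E \in A := mem_upper_single_block W tA i'i.
have PA : P \in A by apply: (mem_diag_single_block tA); case: (D1 i').
have EP : E = P *m E - E *m P.
  by rewrite diag_single_block_mul single_block_mul_diag ?subr0 // neq_ltn i'i.
have conjM M N : Y *m (M *m N) *m X = (Y *m M *m X) *m (Y *m N *m X).
  by rewrite !mulmxA -(mulmxA _ X Y) XY mulmx1.
have dE k : mixed_block hu hu (Y *m E *m X) k k = 0.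
  rewrite EP mulmxBr mulmxBl !conjM.
  by apply: (commutator_diag0 _ CB); apply: conjAB.
have /(mem_of_type tB)[_ uE] := conjAB E EA.
(* In block [(i', j)] of the right side, terms with [k < m] vanish by induction. For [k >= m],
   [j <= m <= k] leaves only diagonal or lower blocks of [Y *m E *m X], which are zero. *)
have -> : E *m X = X *m (Y *m E *m X) by rewrite !mulmxA XY mul1mx.
rewrite (mixed_blockM ht hu hu) big1 // => k _.
have [km|mk] := ltnP k m; first by rewrite IHm ?mul0mx.
have [jk|kj] := ltnP j k; first by rewrite uE ?mulmx0.
suff -> : j = k by rewrite dE mulmx0.
by apply/val_inj/eqP; rewrite eqn_leq kj (leq_trans _ mk).
Qed.

(** The conjugation is tested on the element of [B] whose only possibly nonzero block is [W]; by
    triangularity, diagonal blocks multiply separately. *)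
Lemma conjugated_diag_block t (ht : (\sum_(i < q) tnth t i)%N = n)
    (D C : forall i : 'I_q, {vspace 'M[K]_(tnth t i)}) A B (X Y : 'M[K]_n) i
    (W : 'M[K]_(tnth t i)) :
  is_of_type ht D A -> is_of_type ht C B ->
  upper_triangular ht ht X -> upper_triangular ht ht Y ->
  (forall M, M \in B -> X *m M *m Y \in A) ->
  W \in C i -> mixed_block ht ht X i i *m W *m mixed_block ht ht Y i i \in D i.
Proof.
move=> tA tB uX uY conjBA WC.
have WB := mem_diag_single_block tB WC.
have /(mem_of_type tB)[_ uW] := WB.
have /(mem_of_type tA)[dW _] := conjBA _ WB.
have := dW i; rewrite !(diag_upper_triangularM (hr := ht)) //.
  by rewrite single_blockE.
exact: upper_triangularM uX uW.
Qed.

Lemma conjugated_of_diag_blocks t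
    (ht hu : (\sum_(i < q) tnth t i)%N = n)
    (D C : forall i : 'I_q, {vspace 'M[K]_(tnth t i)}) A B :
  is_of_type ht D A -> is_of_type hu C B ->
  (forall i, conjugated (D i) (C i)) -> conjugated A B.
Proof.
rewrite (eq_irrelevance hu ht) => tA tB conjDC.
(* Finite choice collects the local conjugators into families, assembled below into block diagonal
   matrices. *)
have /fin_all_exists[X] i := iffLR (conjugatedP _ _) (conjDC i).
move=> /fin_all_exists[Y XY].
have X_Y i : X i *m Y i = 1%:M by case: (XY i).
have Y_X i : Y i *m X i = 1%:M by apply: mulmx1C.
apply/conjugatedP; exists (diag_blocks ht X), (diag_blocks ht Y); split.
  apply: (mixed_blockP (hp := ht) (hr := ht)) => i j.
  rewrite -(diag_blocks1 K ht) mul_diag_blocks.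
  have [<-|ij] := eqVneq i j; first by rewrite !diag_blocksE.
  by rewrite !diag_blocks0 ?mulmx0.
move=> M; split=> [/(mem_of_type tB)[dM uM]|/(mem_of_type tA)[dM uM]].
  apply/(mem_of_type tA); split=> [i|i j ji].
    by rewrite mul_mx_diag_blocks mul_diag_blocks; apply: (iffLR ((XY i).2 _)) (dM i).
  by rewrite mul_mx_diag_blocks mul_diag_blocks uM ?mulmx0 ?mul0mx.
apply/(mem_of_type tB); split=> [i|i j ji].
  by apply: (iffRL ((XY i).2 _)); rewrite -mul_diag_blocks -mul_mx_diag_blocks.
(* The invertible factors [X i] and [Y j] are cancelled from the zero block. *)
have := uM i j ji; rewrite mul_mx_diag_blocks mul_diag_blocks => XMY0.
have : Y i *m (X i *m mixed_block ht ht M i j *m Y j) *m X j = 0.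
  by rewrite XMY0 mulmx0 mul0mx.
by rewrite !mulmxA Y_X mul1mx -mulmxA Y_X mulmx1.
Qed.

End BlockAlgebras.

Theorem theorem4p10 (K : fieldType) (q n : nat) (hq : (2 <= q)%N)
    (nn ll : q.-tuple nat)
    (hnn : (\sum_(i < q) tnth nn i)%N = n)
    (hll : (\sum_(i < q) tnth ll i)%N = n)
    (A B : {vspace 'M[K]_n})
    (Ad : forall i : 'I_q, {vspace 'M[K]_(tnth nn i)})
    (Bd : forall i : 'I_q, {vspace 'M[K]_(tnth ll i)})
    (hA : is_Dq_max_comm hnn Ad A)
    (hB : is_Dq_max_comm hll Bd B) :
  conjugated A B <->
  exists e : nn = ll, forall i : 'I_q,
    conjugated (ecast t {vspace 'M[K]_(tnth t i)} e (Ad i)) (Bd i).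
Proof.
have [tA _] := hA; have [tB _] := hB; split; last first.
  case=> e; case: _ / e hll Bd hB tB => hll Bd _ tB /=.
  exact: conjugated_of_diag_blocks tA tB.
case/conjugatedP=> X [Y [XY conjBA]]; have YX := mulmx1C XY.
have toB M : M \in A -> Y *m M *m X \in B.
  by move=> MA; apply/conjBA; rewrite !mulmxA XY mul1mx -mulmxA XY mulmx1.
have toA M : M \in B -> X *m M *m Y \in A by move/conjBA.
have uX := conjugator_upper_triangular hA hB XY toB.
have uY := conjugator_upper_triangular hB hA YX toA.
have XYd i : mixed_block hnn hll X i i *m mixed_block hll hnn Y i i = 1%:M.
  by rewrite -diag_upper_triangularM // XY mixed_block1.
have YXd i : mixed_block hll hnn Y i i *m mixed_block hnn hll X i i = 1%:M.
  by rewrite -diag_upper_triangularM // YX mixed_block1.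
(* The possibly rectangular diagonal blocks of [X] and [Y] are inverse on both sides, so each size
   bounds the other. *)
have e : nn = ll.
  apply: eq_from_tnth => i; apply/eqP; rewrite eqn_leq.
  by rewrite (mulmx1_min (XYd i)) (mulmx1_min (YXd i)).
exists e; case: _ / e hll Bd hB tB uX uY XYd YXd => hll Bd _ /=.
rewrite (eq_irrelevance hll hnn) => tB uX uY XYd YXd i.
apply/conjugatedP; exists (mixed_block hnn hnn X i i), (mixed_block hnn hnn Y i i).
split=> // W; split; first exact: conjugated_diag_block tA tB uX uY toA.
(* The converse is the same lemma with [X] and [Y] exchanged, after which the inverse blocks cancel
   around [W]. *)
move=> /(conjugated_diag_block tB tA uY uX toB).
by rewrite !mulmxA YXd mul1mx -mulmxA YXd mulmx1.
Qed.
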